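(* Let $0<q<1$, let $$\tau_0(t,q)=1+qt,\qquad \tau_{2n}(t,q)=q^n\,\frac{1+q^{n+1}t^{n+1}}{1+q^nt^n}\ (n\ge 1),\qquad \tau_{2n+1}(t,q)=q^{n+1}t\,\frac{1+t^n}{1+t^{n+1}}\ (n\ge 0),$$ and define $L_n(x,t,q)$ by $$L_n(x,t,q)=x\,L_{n-1}(x,qt,q)-\tau_{n-2}(t,q)\,L_{n-2}(x,t,q)\qquad(n\ge 2)$$ with $L_0(x,t,q)=1$ and $L_1(x,t,q)=x$. Let $M$ denote the linear functional on polynomials in $x$ defined by $M(L_n(x,t,q))=[n=0]$ for all $n\ge 0$. Then for all $n\ge 0$ $$M(x^{2n})=M_n(t,q)=\sum_{j=0}^{n}q^{j^2}\begin{bmatrix} n\\ j\end{bmatrix}^2t^j .$$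
   Context: Throughout $q$ is a real number with $0<q<1$, and $t$ is an indeterminate; $L_{n-1}(x,qt,q)$ means that $t$ is replaced by $qt$ in $L_{n-1}(x,t,q)$. The $L_n(x,t,q)$ are polynomials in $x$, monic of degree $n$, with coefficients in the field $\mathbb{R}(t)$ of rational functions in $t$, and $M$ is $\mathbb{R}(t)$-linear on $\mathbb{R}(t)[x]$. Notation: $(q;q)_n=\prod_{i=1}^n(1-q^i)$; $\begin{bmatrix} n\\ k\end{bmatrix}=\frac{(q;q)_n}{(q;q)_k(q;q)_{n-k}}$ for $0\le k\le n$. The Iverson bracket $[n=0]$ equals $1$ if $n=0$ and $0$ otherwise. *)

(* Defs.v *)
From HB Require Import structures.
From mathcomp Require Import all_boot all_order all_algebra.
From mathcomp Require Import reals.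

Set Implicit Arguments.
Unset Strict Implicit.
Unset Printing Implicit Defensive.

Import Order.TTheory GRing.Theory Num.Theory.
Local Open Scope ring_scope.
Local Open Scope quotient_scope.

Notation ratfun R := {fraction {poly R}}.

Local Notation "p %:F" := (FracField.tofrac p) : ring_scope.

Definition tvar (R : realType) : ratfun R := ('X : {poly R})%:F.

Definition tcst (R : realType) (c : R) : ratfun R := (c%:P)%:F.

Definition qpoch (R : realType) (q : R) (n : nat) : R :=
  \prod_(1 <= i < n.+1) (1 - q ^+ i).

(* Only meaningful for k <= n: n - k is truncated. *)
Definition qbinom (R : realType) (q : R) (n k : nat) : R :=
  qpoch q n / (qpoch q k * qpoch q (n - k)).

(* f(t) |-> f(qt), computed on the representative of f chosen by the quotient;
   for q != 0 the result does not depend on that choice (subst_qt_div). *)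
Definition subst_qt (R : realType) (q : R) (f : ratfun R) : ratfun R :=
  (\n_(repr f) \Po (q *: 'X))%:F / (\d_(repr f) \Po (q *: 'X))%:F.

Definition tau (R : realType) (q : R) (n : nat) : ratfun R :=
  let t := tvar R in
  let c := tcst q in
  let m := n./2 in
  if n == 0 then 1 + c * t
  else if odd n then c ^+ m.+1 * t * ((1 + t ^+ m) / (1 + t ^+ m.+1))
  else c ^+ m * ((1 + c ^+ m.+1 * t ^+ m.+1) / (1 + c ^+ m * t ^+ m)).

(* The indeterminate 'X is x; map_poly (subst_qt q) replaces t by qt in every
   coefficient. *)
Fixpoint Lpol (R : realType) (q : R) (n : nat) : {poly ratfun R} :=
  match n with
  | 0 => 1
  | 1 => 'X
  | (m.+1 as k).+1 =>
      'X * map_poly (subst_qt q) (Lpol q k) - (tau q m)%:P * Lpol q m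
  end.

Section SubstTheory.
Variables (R : realType) (q : R).
Hypothesis q_neq0 : q != 0.

Lemma comp_qX_eq0 (p : {poly R}) : (p \Po (q *: 'X) == 0) = (p == 0).
Proof. by rewrite comp_poly2_eq0 // size_scale // size_polyX. Qed.

Lemma ratfun_repr (f : ratfun R) : f = (\n_(repr f))%:F / (\d_(repr f))%:F.
Proof.
have d0 : (\d_(repr f))%:F != 0 :> ratfun R by rewrite tofrac_eq0 denom_ratioP.
apply/(mulIf d0); rewrite mulfVK //.
rewrite -{1}[f]reprK; unlock FracField.tofrac.
rewrite -[LHS]FracField.pi_mul; apply/eqmodP => /=.
rewrite FracField.equivfE /= !numden_Ratio ?(oner_neq0, mulr1) ?mul1r //.
- by rewrite mulrC.
all: exact: denom_ratioP.
Qed.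

Lemma subst_qt_div (a b : {poly R}) : b != 0 ->
  subst_qt q (a%:F / b%:F) = (a \Po (q *: 'X))%:F / (b \Po (q *: 'X))%:F.
Proof.
move=> b0; set f := _ / _; rewrite /subst_qt.
have d0 : \d_(repr f) != 0 := denom_ratioP _.
apply/eqP; rewrite eqr_div ?tofrac_eq0 ?comp_qX_eq0 //.
rewrite -!tofracM tofrac_eq -!comp_polyM; apply/eqP; congr (_ \Po _).
apply/eqP; rewrite -tofrac_eq !tofracM.
by rewrite -eqr_div ?tofrac_eq0 // -ratfun_repr.
Qed.

Lemma subst_qt_tofrac (a : {poly R}) :
  subst_qt q a%:F = (a \Po (q *: 'X))%:F.
Proof.
rewrite -[a%:F]divr1 -[1 in LHS]tofrac1 subst_qt_div ?oner_neq0 //.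
by rewrite comp_polyC tofrac1 divr1.
Qed.

Lemma subst_qt_is_zmod_morphism : zmod_morphism (subst_qt q).
Proof.
move=> f g; rewrite [f]ratfun_repr [g]ratfun_repr.
move: (repr f) (repr g) => [[a b] /= b0] [[c d] /= d0].
have tn0 (p : {poly R}) : p != 0 -> p%:F != 0 :> ratfun R by rewrite tofrac_eq0.
rewrite -mulNr addf_div ?tn0 // -tofracN -!tofracM -tofracD.
rewrite !subst_qt_div ?mulf_neq0 // -mulNr addf_div ?tn0 ?comp_qX_eq0 //.
by rewrite -tofracN -!tofracM -tofracD -!comp_polyM -raddfN -!comp_polyM -raddfD.
Qed.

Lemma subst_qt_is_monoid_morphism : monoid_morphism (subst_qt q).
Proof.
split=> [|f g].
  by rewrite -tofrac1 subst_qt_tofrac comp_polyC.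
rewrite [f]ratfun_repr [g]ratfun_repr.
move: (repr f) (repr g) => [[a b] /= b0] [[c d] /= d0].
rewrite mulf_div -!tofracM !subst_qt_div ?mulf_neq0 //.
by rewrite mulf_div -!tofracM !comp_polyM.
Qed.

Definition subst_qt_rmorphism : {rmorphism ratfun R -> ratfun R} :=
  HB.pack (subst_qt q)
    (GRing.isZmodMorphism.Build _ _ _ subst_qt_is_zmod_morphism)
    (GRing.isMonoidMorphism.Build _ _ _ subst_qt_is_monoid_morphism).

Lemma LpolSS (n : nat) :
  Lpol q n.+2 = 'X * map_poly (subst_qt q) (Lpol q n.+1)
                - (tau q n)%:P * Lpol q n.
Proof. reflexivity. Qed.

Lemma size_Lpol_monic (n : nat) :
  size (Lpol q n) = n.+1 /\ Lpol q n \is monic.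
Proof.
suff: (size (Lpol q n) = n.+1 /\ Lpol q n \is monic) /\
      (size (Lpol q n.+1) = n.+2 /\ Lpol q n.+1 \is monic) by case.
elim: n => [|n [[sn mn] [sm mm]]].
  by rewrite /= size_poly1 size_polyX monic1 monicX.
split; first by split.
rewrite LpolSS; set P := map_poly _ _.
have sP : size P = n.+2 by rewrite (size_map_poly subst_qt_rmorphism).
have mP : P \is monic by rewrite (map_monic subst_qt_rmorphism).
have sXP : size ('X * P) = n.+3.
  by rewrite mulrC size_mulX ?sP // monic_neq0.
have lt : (size (- ((tau q n)%:P * Lpol q n))%R < size ('X * P)%R)%N.
  rewrite size_polyN sXP mul_polyC.
  by apply: leq_ltn_trans (size_scale_leq _ _) _; rewrite sn.
split; first by rewrite size_polyDl.
rewrite monicE lead_coefDl; last exact: lt.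
by rewrite [in lead_coef _]mulrC lead_coefMX -monicE.
Qed.

(* M exists because L_n is monic of degree n; it is unique for the same reason. *)
Theorem Mfunctional_exists :
  exists M : {scalar {poly ratfun R}}, forall n, M (Lpol q n) = (n == 0%N)%:R.
Proof.
pose K := ratfun R; pose L := Lpol q.
pose fix mus (n : nat) : seq K :=
  if n is m.+1 then
    rcons (mus m) ((m == 0%N)%:R - \sum_(i < m) (L m)`_i * (mus m)`_i)
  else [::].
have smus n : size (mus n) = n by elim: n => //= n IH; rewrite size_rcons IH.
pose mu i := (mus i.+1)`_i.
have musE n i : (i < n)%N -> (mus n)`_i = mu i.
  elim: n => // n IH; rewrite ltnS leq_eqVlt => /orP[/eqP-> //|lt].
  by rewrite /= nth_rcons smus lt IH.
pose M (p : {poly K}) : K := \sum_(i < size p) p`_i * mu i.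
have ME N (p : {poly K}) : (size p <= N)%N -> M p = \sum_(i < N) p`_i * mu i.
  move=> le; rewrite /M (big_ord_widen _ (fun i => p`_i * mu i) le) big_mkcond.
  apply: eq_bigr => i _; case: ltnP => // le'.
  by rewrite nth_default // mul0r.
have Mz : zmod_morphism M.
  move=> p r; pose N := maxn (size p) (size r).
  rewrite !(ME N) ?leq_maxl ?leq_maxr //; last first.
    by rewrite (leq_trans (size_polyD _ _)) // size_polyN.
  by rewrite -sumrB; apply: eq_bigr => i _; rewrite coefB mulrBl.
have Ms : scalable_for *%R M.
  move=> a p; rewrite (ME (size p)) ?size_scale_leq // mulr_sumr.
  by apply: eq_bigr => i _; rewrite coefZ mulrA.
pose M' : {scalar {poly K}} := HB.pack M
  (GRing.isZmodMorphism.Build _ _ _ Mz) (GRing.isScalable.Build _ _ _ _ _ Ms).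
exists M' => n; have [sL mL] := size_Lpol_monic n.
rewrite [LHS](ME n.+1) ?sL // big_ord_recr /=.
have -> : (Lpol q n)`_n = 1 by rewrite -(monicP mL) lead_coefE sL.
rewrite mul1r [X in _ + X]/mu /= nth_rcons smus ltnn eqxx addrC.
have -> : \sum_(i < n) (Lpol q n)`_i * mu i =
          \sum_(i < n) (L n)`_i * (mus n)`_i.
  by apply: eq_bigr => i _; rewrite (musE n).
by rewrite subrK.
Qed.

End SubstTheory.

(* Main.v *)
Require Import Defs.
From HB Require Import structures.
From mathcomp Require Import all_boot all_order all_algebra.
From mathcomp Require Import reals.
From mathcomp Require Import ring.

Set Implicit Arguments.
Unset Strict Implicit.
Unset Printing Implicit Defensive.

Import Order.TTheory GRing.Theory Num.Theory.
Local Open Scope ring_scope.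

(**
Let S be the substitution t |-> qt. Since x S(L_n) = L_{n+1} + tau_{n-1} L_{n-1},
applying S and multiplying by x twice gives, the denominators cancelling,
  x^2 S^2(L_{2k}) = L_{2k+2} + q^k (1 + qt) L_{2k} + q^{2k} t L_{2k-2}
(doubled last term for k = 1, none for k = 0). The polynomials
  A(n,k) = \sum_j q^{j(j+k)} [n, j] [n, j+k] t^j
satisfy the transposed recurrence: after dividing by q^{j(j+k)} the coefficient
of t^j is the product of the Pascal rules for [n+1, j] and [n+1, j+k]. Hence
x^{2n} = \sum_k A(n,k) L_{2k} by induction on n, and M extracts A(n,0).
*)

(** * Gaussian binomials from the Pascal rule *)

(* Unlike qbinom, gauss q n k vanishes for k > n, so that the recurrences below
   hold with no bound on the indices. *)
Fixpoint gauss (R : nzRingType) (q : R) (n k : nat) : R :=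
  match n, k with
  | _, 0 => 1
  | 0, _.+1 => 0
  | n'.+1, k'.+1 => gauss q n' k' + q ^+ k * gauss q n' k
  end.

Arguments gauss : simpl never.

Lemma gauss0 (R : nzRingType) (q : R) n : gauss q n 0 = 1.
Proof. by case: n. Qed.

Lemma gaussS (R : nzRingType) (q : R) n k :
  gauss q n.+1 k.+1 = gauss q n k + q ^+ k.+1 * gauss q n k.+1.
Proof. by []. Qed.

Lemma gauss_small (R : nzRingType) (q : R) n k : (n < k)%N -> gauss q n k = 0.
Proof.
elim: n k => [|n IHn] [|k] //; rewrite ltnS => lt_nk.
by rewrite gaussS !IHn ?mulr0 ?addr0 // ltnW.
Qed.

Lemma qpochS (R : realType) (q : R) n :
  qpoch q n.+1 = qpoch q n * (1 - q ^+ n.+1).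
Proof. by rewrite /qpoch big_nat_recr. Qed.

Lemma qpoch_neq0 (R : realType) (q : R) n : 0 < q -> q < 1 -> qpoch q n != 0.
Proof.
move=> q0 q1; elim: n => [|n IHn]; first by rewrite /qpoch big_geq ?oner_eq0.
rewrite qpochS mulf_neq0 // subr_eq0 eq_sym lt_eqF //.
by rewrite exprn_ilt1 // ltW.
Qed.

(** Written without division or subtraction of indices, so that a double induction on [m] and [k]
    can use the Pascal rule directly for every [q]. *)
Lemma gauss_qpoch (R : realType) (q : R) m k :
  gauss q (m + k) k * (qpoch q k * qpoch q m) = qpoch q (m + k).
Proof.
have qpoch0 : qpoch q 0 = 1 by rewrite /qpoch big_geq.
elim: m k => [|m IHm] k; last elim: k => [|k IHk].
- elim: k => [|k IHk]; first by rewrite gauss0 qpoch0 !mul1r.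
  rewrite add0n qpoch0 mulr1 in IHk *.
  rewrite [gauss _ _ _]gaussS (gauss_small q (ltnSn k)) mulr0 addr0.
  by rewrite qpochS mulr1 mulrA IHk.
- by rewrite addn0 gauss0 qpoch0 !mul1r.
have IHm' := IHm k.+1; rewrite addSnnS qpochS in IHk.
have -> : (m.+1 + k.+1 = (m + k.+1).+1)%N by [].
rewrite gaussS [RHS]qpochS !qpochS.
(* The two summands match the two terms of the Pascal rule, and so the two induction hypotheses. *)
have -> : 1 - q ^+ (m + k.+1).+1 =
    (1 - q ^+ k.+1) + q ^+ k.+1 * (1 - q ^+ m.+1).
  by rewrite -addSn exprD; ring.
rewrite [RHS]mulrDr -[X in X * _ + _]IHk -[X in _ + X * _]IHm' !qpochS; ring.
Qed.

Lemma qbinom_gauss (R : realType) (q : R) n k :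
  0 < q -> q < 1 -> (k <= n)%N -> qbinom q n k = gauss q n k.
Proof.
move=> q0 q1 le_kn; rewrite /qbinom.
have := gauss_qpoch q (n - k) k; rewrite subnK // => <-.
by rewrite mulfK // mulf_neq0 ?qpoch_neq0.
Qed.

(** * The coefficients A(n,k) and their recurrence *)

Definition Acoef (R : realType) (q : R) (n k : nat) : {poly R} :=
  \poly_(j < n.+1) (q ^+ (j * (j + k)) * gauss q n j * gauss q n (j + k)).

Lemma coef_Acoef (R : realType) (q : R) n k j :
  (Acoef q n k)`_j = q ^+ (j * (j + k)) * gauss q n j * gauss q n (j + k).
Proof.
rewrite coef_poly; case: ltnP => // lt_nj.
by rewrite (gauss_small _ lt_nj) mulr0 mul0r.
Qed.

Lemma Acoef_small (R : realType) (q : R) n k : (n < k)%N -> Acoef q n k = 0.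
Proof.
move=> lt_nk; apply/polyP=> j.
by rewrite coef_Acoef coef0 (gauss_small _ (ltn_addl j lt_nk)) mulr0.
Qed.

Lemma coef_comp_scaleX (R : comNzRingType) (a : R) (p : {poly R}) i :
  (p \Po (a *: 'X))`_i = a ^+ i * p`_i.
Proof.
elim/poly_ind: p i => [|p c IHp] i; first by rewrite comp_poly0 !coef0 mulr0.
rewrite comp_polyD comp_polyM comp_polyX comp_polyC !coefD !coefC.
rewrite -scalerAr coefZ !coefMX; case: i => [|i] /=.
  by rewrite !mulr0 !add0r expr0 mul1r.
by rewrite !addr0 IHp exprS mulrA.
Qed.

Section Recurrence.
Variables (R : realType) (q : R).

Let sh2 (p : {poly R}) := (p \Po (q *: 'X)) \Po (q *: 'X).

(** The product of two Pascal rules has four terms; they come from A(n,k), from the summands 1 and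
    qt of the middle factor, and from A(n,k+2). *)
Lemma AcoefSS n k :
  Acoef q n.+1 k.+1 = sh2 (Acoef q n k)
    + (q ^+ k.+1 *: (1 + q *: 'X)) * sh2 (Acoef q n k.+1)
    + (q ^+ (2 * k.+2) *: 'X) * sh2 (Acoef q n k.+2).
Proof.
apply/polyP=> j; rewrite -!scalerAl mulrDl mul1r -scalerAl.
rewrite !(coefD, coefZ, coefXM, coef_comp_scaleX, coef_Acoef).
case: j => [|j] /=.
  by rewrite !mul0n !expr0 !gauss0 !add0n gaussS !mulr0 !addr0; ring.
rewrite !addSn !addnS !(gaussS q n).
rewrite !(mulSn, mulnS, mulnDr, addnS, addSn, muln0, addn0, mul0n, add0n).
rewrite !(exprS, exprD); ring.
Qed.

(** Here a single Pascal rule is squared; its two cross terms coincide, whence the factor 2. *)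
Lemma AcoefS0 n :
  Acoef q n.+1 0 = (1 + q *: 'X) * sh2 (Acoef q n 0)
    + ((2 * q ^+ 2) *: 'X) * sh2 (Acoef q n 1).
Proof.
apply/polyP=> j; rewrite -!scalerAl mulrDl mul1r -scalerAl.
rewrite !(coefD, coefZ, coefXM, coef_comp_scaleX, coef_Acoef).
case: j => [|j] /=.
  by rewrite !mul0n !expr0 !gauss0; ring.
rewrite !addn0 addn1 !(gaussS q n).
rewrite !(mulSn, mulnS, mulnDr, addnS, addSn, muln0, addn0, mul0n, add0n).
rewrite !(exprS, exprD); ring.
Qed.

End Recurrence.

Arguments Lpol : simpl never.

(** * Transposing a three-term recurrence *)

Lemma tridiagonal_sum (W : comNzRingType) (b u v E X a : nat -> W) n :
  (forall k, (n < k)%N -> b k = 0) ->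
  X 0 = E 1 + u 0 * E 0 ->
  (forall k, X k.+1 = E k.+2 + u k.+1 * E k.+1 + v k * E k) ->
  a 0 = u 0 * b 0 + v 0 * b 1 ->
  (forall k, a k.+1 = b k + u k.+1 * b k.+1 + v k.+1 * b k.+2) ->
  \sum_(k < n.+1) b k * X k = \sum_(k < n.+2) a k * E k.
Proof.
move=> b_small X0 XS a0 aS.
(* Boundary terms: [X m] already reaches [E m.+1], while [a m] already contains the share of
   [b m.+1]. At m = n the second one vanishes. *)
have partial m : \sum_(k < m.+1) b k * X k =
    \sum_(k < m.+1) a k * E k + b m * E m.+1 - v m * b m.+1 * E m.
  elim: m => [|m IHm]; first by rewrite !big_ord1 X0 a0; ring.
  by rewrite big_ord_recr IHm [in RHS]big_ord_recr /= XS aS; ring.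
rewrite partial [RHS]big_ord_recr /= aS (b_small n.+1) //.
by rewrite (b_small n.+2 (leqW (ltnSn n))); ring.
Qed.

(** * Cancellation of the denominators of tau *)

Section FieldIdentities.
Variables (F : fieldType) (c t : F).

(** With s = ct, the numerators add up to 1 + s + s^(m+1) + s^(m+2) = (1 + s)(1 + s^(m+1)). *)
Lemma tau_sum_field m : 1 + (c * t) ^+ m.+1 != 0 ->
  c ^+ m.+1 * ((1 + c ^+ m.+2 * t ^+ m.+2) / (1 + c ^+ m.+1 * t ^+ m.+1))
    + c ^+ m.+1 * (c * t) * ((1 + (c * t) ^+ m) / (1 + (c * t) ^+ m.+1))
  = c ^+ m.+1 * (1 + c * t).
Proof.
rewrite -!exprMn; set d := 1 + _ => d0.
apply: (mulIf d0); rewrite mulrDl -!mulrA !mulVf // /d !exprS; ring.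
Qed.

Lemma tau_prod_field m : 1 + (c * t) ^+ m != 0 -> 1 + (c * t) ^+ m.+1 != 0 ->
  c ^+ m.+1 * (c * t) * ((1 + (c * t) ^+ m) / (1 + (c * t) ^+ m.+1))
    * (c ^+ m * ((1 + c ^+ m.+1 * t ^+ m.+1) / (1 + c ^+ m * t ^+ m)))
  = c ^+ (2 * m.+1) * t.
Proof.
rewrite -!exprMn; set d := 1 + _ ^+ m; set e := 1 + _ => d0 e0.
have -> : c ^+ (2 * m.+1) = c ^+ m.+1 * c * c ^+ m.
  by rewrite mul2n -addnn exprD -mulrA -exprS.
by field; rewrite d0.
Qed.

Lemma tau_prod0_field : 1 + c * t != 0 ->
  c * (c * t) * ((1 + 1) / (1 + c * t)) * (1 + c * t) = 2 * c ^+ (2 * 1) * t.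
Proof. by move=> d0; rewrite muln1; field. Qed.

End FieldIdentities.

(** * Expansion of the even powers of x in the L_{2k} *)

Section Expansion.
Variables (R : realType) (q : R).
Hypothesis q_gt0 : 0 < q.

Local Notation K := (ratfun R).
Local Notation F := (@FracField.tofrac {poly R}).
Local Notation L := (Lpol q).
Local Notation t := (tvar R).
Local Notation c := (tcst q).

Let q_neq0 : q != 0. Proof. by rewrite gt_eqF. Qed.

(* S is kept abstract because /= would otherwise unfold the packed instance
   subst_qt_rmorphism. *)
Variable S : {rmorphism K -> K}.
Hypothesis SE : S =1 subst_qt q.

Lemma subst_tofrac (p : {poly R}) : S (F p) = F (p \Po (q *: 'X)).
Proof. by rewrite SE subst_qt_tofrac. Qed.

Lemma tofrac_scaleX : F (q *: 'X) = c * t.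
Proof. by rewrite -mul_polyC tofracM. Qed.

Lemma subst_t : S t = c * t.
Proof. by rewrite subst_tofrac comp_polyX tofrac_scaleX. Qed.

Lemma subst_c : S c = c.
Proof. by rewrite subst_tofrac comp_polyC. Qed.

Lemma add1_ct_exp_neq0 m : 1 + (c * t) ^+ m != 0.
Proof.
rewrite -tofrac_scaleX -tofracXn -tofrac1 -tofracD tofrac_eq0.
(* At 1 the polynomial takes the value 1 + q^m > 0. *)
apply/eqP => /(congr1 (horner^~ 1)) /eqP.
by rewrite !hornerE gt_eqF // ltr_wpDr // exprn_ge0 // ltW.
Qed.

Let mulX_Lpol n : 'X * map_poly S (L n.+1) = L n.+2 + (tau q n)%:P * L n.
Proof. by rewrite LpolSS (eq_map_poly SE) subrK. Qed.

(** S acts on coefficients only, so this operator still sends x^(2n) to x^(2n+2), while the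
    denominators in the recurrence of the L_{2k} cancel. *)
Let Lshift2 (p : {poly K}) := 'X^2 * map_poly S (map_poly S p).

Lemma Lshift2S n : Lshift2 (L n.+2) = L n.+4
  + (tau q n.+2 + S (tau q n.+1))%:P * L n.+2
  + (S (tau q n.+1) * tau q n)%:P * L n.
Proof.
have -> : Lshift2 (L n.+2) = 'X * map_poly S ('X * map_poly S (L n.+2)).
  by rewrite rmorphM /= map_polyX /Lshift2 expr2 mulrA.
rewrite mulX_Lpol rmorphD rmorphM /= map_polyC mulrDr mulrCA !mulX_Lpol /=.
(* ring diverges on the concrete L's, which it compares up to conversion. *)
rewrite polyCD polyCM; move: (L _) (L _) (L _) (_%:P) (_%:P) (_%:P).
by move=> *; ring.
Qed.

Lemma tau_even m : tau q m.+1.*2 =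
  c ^+ m.+1 * ((1 + c ^+ m.+2 * t ^+ m.+2) / (1 + c ^+ m.+1 * t ^+ m.+1)).
Proof. by rewrite /tau odd_double doubleK. Qed.

Lemma tau_odd m : tau q m.*2.+1 =
  c ^+ m.+1 * t * ((1 + t ^+ m) / (1 + t ^+ m.+1)).
Proof. by rewrite /tau /= odd_double uphalf_double. Qed.

Lemma tau_sum m : tau q m.+1.*2 + S (tau q m.*2.+1) = c ^+ m.+1 * (1 + c * t).
Proof.
rewrite tau_even tau_odd.
rewrite !(rmorphM, rmorphXn, fmorphV, rmorphD, rmorph1) /= subst_t subst_c.
exact/tau_sum_field/add1_ct_exp_neq0.
Qed.

(* The factor 2 at m = 0 comes from tau_0, which is twice the value at n = 0 of
   the formula for tau_{2n}. *)
Definition lower m : K := (if m is 0 then 2 else 1) * c ^+ (2 * m.+1) * t.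

Lemma tau_prod m : S (tau q m.*2.+1) * tau q m.*2 = lower m.
Proof.
rewrite /lower tau_odd.
rewrite !(rmorphM, rmorphXn, fmorphV, rmorphD, rmorph1) /= subst_t subst_c.
case: m => [|m]; last first.
  by rewrite mul1r tau_even tau_prod_field ?add1_ct_exp_neq0.
have /= := add1_ct_exp_neq0 1; rewrite /tau /= !expr1 expr0.
exact: tau_prod0_field.
Qed.

Lemma Lshift2_0 : Lshift2 (L 0) = L 2 + (1 + c * t)%:P * L 0.
Proof.
rewrite -[1 + c * t]/(tau q 0) -mulX_Lpol /Lshift2 !rmorph1 mulr1.
by rewrite -['X^2]/('X * 'X) [L 1]/('X) map_polyX.
Qed.

Lemma Lshift2_double m : Lshift2 (L m.+1.*2) = L m.+2.*2
  + (c ^+ m.+1 * (1 + c * t))%:P * L m.+1.*2 + (lower m)%:P * L m.*2.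
Proof. by rewrite Lshift2S tau_sum tau_prod. Qed.

Let A n k : K := F (Acoef q n k).
(** [Lshift2] is only semilinear: a scalar A(n,k) comes out of it as B(n,k). *)
Let B n k : K := S (S (A n k)).

Let BE n k : B n k = F ((Acoef q n k \Po (q *: 'X)) \Po (q *: 'X)).
Proof. by rewrite /B !subst_tofrac. Qed.

Lemma A_recSS n k : A n.+1 k.+1 =
  B n k + c ^+ k.+1 * (1 + c * t) * B n k.+1 + lower k.+1 * B n k.+2.
Proof.
rewrite !BE /A AcoefSS !tofracD !tofracM -!mul_polyC !tofracM !tofracD tofracM.
by rewrite /lower mul1r tofrac1 !rmorphXn.
Qed.

Lemma A_recS0 n : A n.+1 0 = (1 + c * t) * B n 0 + lower 0 * B n 1.
Proof.
rewrite !BE /A AcoefS0 !tofracD !tofracM -!mul_polyC !tofracM !tofracD tofrac1.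
by rewrite /lower tofracM polyCM tofracM !rmorphXn !rmorph_nat.
Qed.

Lemma B_small n k : (n < k)%N -> B n k = 0.
Proof. by move=> nk; rewrite /B /A Acoef_small // tofrac0 !rmorph0. Qed.

Lemma Xn_expansion n : 'X^(2 * n) = \sum_(k < n.+1) (A n k)%:P * L k.*2.
Proof.
elim: n => [|n IHn].
  rewrite big_ord_recl big_ord0 addr0 mulr1 /A.
  suff -> : Acoef q 0 0 = 1 by rewrite tofrac1.
  apply/polyP=> [] [|j]; rewrite coef_Acoef coefC.
    by rewrite gauss0 !mulr1.
  by rewrite (gauss_small q (ltn0Sn j)) mulr0.
have -> : 'X^(2 * n.+1) = Lshift2 'X^(2 * n).
  by rewrite /Lshift2 !map_polyXn -exprD mulnS.
rewrite IHn.
have -> : Lshift2 (\sum_(k < n.+1) (A n k)%:P * L k.*2) =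
    \sum_(k < n.+1) (B n k)%:P * Lshift2 (L k.*2).
  rewrite /Lshift2 !rmorph_sum mulr_sumr; apply: eq_bigr => k _.
  by rewrite !rmorphM /= !map_polyC mulrCA.
(* At k = 0 this is the coefficient 1 + qt of L_0 in [Lshift2_0], so one formula serves all k. *)
pose u k := (c ^+ k * (1 + c * t))%:P : {poly K}.
apply: (@tridiagonal_sum _ (fun k => (B n k)%:P) u (fun k => (lower k)%:P)
  (fun k => L k.*2) (fun k => Lshift2 (L k.*2)) (fun k => (A n.+1 k)%:P)).
- by move=> k /B_small ->.
- by rewrite Lshift2_0 /u expr0 mul1r.
- by move=> k; rewrite Lshift2_double.
- by rewrite A_recS0 polyCD !polyCM /u expr0 mul1r.
- by move=> k; rewrite A_recSS /u !polyCD 3!polyCM.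
Qed.

End Expansion.

Theorem theorem2 (R : realType) (q : R) (hq0 : 0 < q) (hq1 : q < 1)
    (M : {scalar {poly ratfun R}})
    (hM : forall n : nat, M (Lpol q n) = (n == 0%N)%:R) (n : nat) :
  M 'X^(2 * n) =
    \sum_(j < n.+1) tcst (q ^+ (j ^ 2) * qbinom q n j ^+ 2) * tvar R ^+ j.
Proof.
pose S := subst_qt_rmorphism (lt0r_neq0 hq0).
rewrite (Xn_expansion hq0 (S := S) (frefl _)) linear_sum /=.
(* M kills L_{2k} for k > 0, so that only A(n,0) remains. *)
rewrite big_ord_recl big1 => [|k _]; last first.
  by rewrite mul_polyC linearZ /= hM mulr0.
rewrite mul_polyC linearZ /= hM mulr1 addr0 /Acoef poly_def rmorph_sum /=.
apply: eq_bigr => j _; rewrite -mul_polyC tofracM tofracXn addn0.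
rewrite qbinom_gauss //; last by rewrite -ltnS.
by rewrite -mulnn expr2 mulrA.
Qed.
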